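(* Let $N$ be a pointed metric space, regard $[0,1]$ (with its usual metric) as a pointed metric space, and let $\phi:N\to[0,1]$ be a $1$-Lipschitz function which maps the distinguished point of $N$ to that of $[0,1]$, and such that $\phi(N)$ has length (Lebesgue measure) $1$. Assume that for every $t\in\phi(N)$ there exists $x\in N$ such that $\phi(x)=t$ and $$\mathrm{Lip}\,\phi(x)=1,$$ where $\mathrm{Lip}\,\phi(x)$ is the pointwise Lipschitz constant of $\phi$ at $x$. Then the composition operator $C_\phi:\mathrm{Lip}_0([0,1])\to\mathrm{Lip}_0(N)$, $C_\phi(f)=f\circ\phi$, is an isometry.
   Context: A pointed metric space is a metric space with a distinguished point. For a pointed metric space $M$, $\mathrm{Lip}_0(M)$ is the real Banach space of all Lipschitz functions $f:M\to\mathbb R$ vanishing at the distinguished point, with norm $\|f\|=\sup\{\frac{f(x)-f(y)}{d(x,y)}: x\neq y\in M\}$. ''$C_\phi$ is an isometry'' means $\|C_\phi(f)\|=\|f\|$ for all $f$ in its domain (no surjectivity is required). For a Lipschitz function $f:N\to\mathbb R$ on a metric space $N$, the pointwise Lipschitz constant of $f$ at a non-isolated point $x\in N$ is $$\mathrm{Lip}\,f(x):=\limsup_{y\to x,\ y\neq x}\frac{f(y)-f(x)}{d(y,x)},$$ and $\mathrm{Lip}\,f(x):=0$ if $x$ is an isolated point of $N$. *)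

(* Defs.v *)
From HB Require Import structures.
From mathcomp Require Import all_boot all_order all_algebra.
From mathcomp Require Import all_classical all_reals all_analysis.

Set Implicit Arguments.
Unset Strict Implicit.
Unset Printing Implicit Defensive.

Import Order.TTheory GRing.Theory Num.Theory.
Import numFieldNormedType.Exports.

Local Open Scope classical_set_scope.
Local Open Scope ring_scope.

(* The library equips the subtype of a set with the induced pseudometric;
   this adds the restricted distance, i.e. the metricType structure. *)
Section subset_metric.
Context {R : realType} {X : metricType R} (A : set X).

Let dist (x y : A) : R := mdist (set_val x) (set_val y).

Let dist_ge0 x y : 0 <= dist x y.
Proof. exact: mdist_ge0. Qed.

Let dist_positivity x y : dist x y = 0 -> x = y.
Proof. by move=> /mdist_positivity/val_inj. Qed.

Let ballEdist (x : A) d : ball x d = [set y | dist x y < d].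
Proof.
have -> : ball x d = set_val @^-1` ball (set_val x) d by [].
by rewrite ballEmdist.
Qed.

HB.instance Definition _ := @PseudoMetric_isMetric.Build R (set_type A)
  dist dist_ge0 dist_positivity ballEdist.

End subset_metric.

(* [R^o] is the alias of R on which the library puts the metric |y - x|. *)
Definition unit_interval (R : realType) : set R^o := `[0, 1]%classic.
Arguments unit_interval : clear implicits.

Section lipschitz_spaces.
Context {R : realType}.

Definition lipschitz_map {M M' : metricType R} (k : R) (f : M -> M') :=
  forall x y, mdist (f x) (f y) <= k * mdist x y.

(* The Lipschitz functions on M vanishing at the distinguished point p. *)
Definition Lip0 {M : metricType R} (p : M) : set (M -> R) :=
  [set f | (exists k : R, lipschitz_map k (f : M -> R^o)) /\ f p = 0].

Definition lip_norm {M : metricType R} (f : M -> R) : R :=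
  sup [set r | exists x y : M, x != y /\ r = (f x - f y) / mdist x y].

(* Valued in [\bar R] because the library's limsup along a filter is; it is a
   finite real number as soon as f is Lipschitz. *)
Definition pointwise_lip {M : metricType R} (f : M -> R) (x : M) : \bar R :=
  if `[< isolated [set: M] x >] then 0%E
  else limf_esup (fun y => ((f y - f x) / mdist y x)%:E) x^'.

Definition isometric_on {M M' : metricType R} (A : set (M -> R))
    (B : set (M' -> R)) (T : (M -> R) -> (M' -> R)) :=
  forall f, A f -> B (T f) /\ lip_norm (T f) = lip_norm f.

End lipschitz_spaces.

Definition composition_op {R M M' : Type} (phi : M -> M') (f : M' -> R) : M -> R :=
  f \o phi.

(* Main.v *)
(* The inequality [lip_norm (f \o phi) <= lip_norm f] is clear.  Conversely let
   [c] be the norm of [f \o phi].  If [t = phi x] with [Lip phi x = 1], there are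
   [y] near [x] for which [s = phi y] lies just to the right of [t] and [s - t] is
   almost [d(y, x)], so that [|f s - f t| <= c' (s - t)] for any given [c' > c].
   The points [t] admitting such an [s] form a set containing the range of [phi],
   and, with strict inequality, an open set, so its complement in [0, 1] is null.
   A Lipschitz function that can be crept along with slope at most [c'] outside a
   null set is [c']-Lipschitz. *)
Require Import Defs.
From mathcomp Require Import all_boot all_order all_algebra.
From mathcomp Require Import all_classical all_reals all_analysis.
From mathcomp Require Import measurable_realfun lra.
Import Order.TTheory GRing.Theory Num.Theory.
Import numFieldNormedType.Exports.
Local Open Scope classical_set_scope.
Local Open Scope ring_scope.

(** * Difference quotients and the Lipschitz norm *)

Lemma lip_quotient_le {R : realType} {M : metricType R} {k : R} {f : M -> R}
    (x y : M) : lipschitz_map k (f : M -> R^o) -> x != y ->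
  (f x - f y) / mdist x y <= k.
Proof.
move=> fk xy; rewrite ler_pdivrMr ?mdist_gt0//.
apply: le_trans (fk x y); rewrite /mdist/= distrC; exact: ler_norm.
Qed.

Lemma lip_norm_le {R : realType} {M : metricType R} {k : R} {f : M -> R}
    (x y : M) : x != y -> lipschitz_map k (f : M -> R^o) -> lip_norm f <= k.
Proof.
move=> xy fk; apply: ge_sup; first by exists ((f x - f y) / mdist x y), x, y.
by move=> _ [x' [y' [xy' ->]]]; exact: lip_quotient_le.
Qed.

(** The constant [k] bounds the difference quotients, so the [sup] is a true least upper bound;
    exchanging the two points yields the absolute value. *)
Lemma lipschitz_lip_norm {R : realType} {M : metricType R} {k : R} {f : M -> R} :
  lipschitz_map k (f : M -> R^o) -> lipschitz_map (lip_norm f) (f : M -> R^o).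
Proof.
move=> fk x y; have [->|xy] := eqVneq x y; first by rewrite !mdistxx mulr0.
have le_sup (x' y' : M) : x' != y' -> f x' - f y' <= lip_norm f * mdist x' y'.
  move=> xy'; rewrite -ler_pdivrMr ?mdist_gt0//; apply: ub_le_sup.
    by exists k => _ [x1 [y1 [xy1 ->]]]; exact: lip_quotient_le.
  by exists x', y'.
rewrite /mdist/= ler_norml; apply/andP; split.
  by rewrite lerNl opprB le_sup.
by rewrite [X in _ * X](metric_sym x y) le_sup// eq_sym.
Qed.

Lemma lip_norm_ge0 {R : realType} {M : metricType R} {k : R} {f : M -> R}
    (x y : M) : x != y -> lipschitz_map k (f : M -> R^o) -> 0 <= lip_norm f.
Proof.
move=> xy /lipschitz_lip_norm/(_ x y).
by move=> /(le_trans (mdist_ge0 _ _)); rewrite pmulr_lge0// mdist_gt0.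
Qed.

(** The limsup is an infimum of suprema over punctured neighbourhoods, so the supremum over each
    punctured ball exceeds [a]. At an isolated point the value is 0, which [0 < a] excludes. *)
Lemma pointwise_lip_witness {R : realType} {M : metricType R} (f : M -> R)
    (x : M) (a : R) (e : R) : 0 < a -> 0 < e -> (a%:E < pointwise_lip f x)%E ->
  exists y, [/\ y != x, mdist y x < e & a < (f y - f x) / mdist y x].
Proof.
rewrite /pointwise_lip => a0 e0; case: ifPn => _.
  by rewrite lte_fin ltNge ltW.
move=> /lt_le_trans /(_ (ereal_inf_lbound _)) => H.
have /ereal_sup_gt[_ /= [y [xy /= yx] <-]] :
    (a%:E < ereal_sup [set ((f y - f x) / mdist y x)%:E | y in ball x e `\ x])%E.
  apply: H; exists (ball x e `\ x) => //; exact: dnbhs_ball.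
rewrite lte_fin => ay; exists y; split => //; first exact/eqP.
by move: xy; rewrite ballEmdist metric_sym.
Qed.

(** * Slope estimates on the line outside a null set *)

Lemma lipschitz_const_ge0 {R : realType} (F : R -> R) (L : R) :
  (forall x y, `|F x - F y| <= L * `|x - y|) -> 0 <= L.
Proof.
move=> FL; have := FL 0 1; rewrite sub0r normrN normr1 mulr1; exact: le_trans.
Qed.

(* Continuous induction: [sup [set x | H x - m x <= H u - m u]] belongs to the
   set, since [H] is continuous and [m] can only jump up. *)
Lemma creeping {R : realType} (u v K : R) (H m : R -> R) :
  u <= v -> (forall x y, `|H x - H y| <= K * `|x - y|) ->
  {homo m : x y / x <= y} ->
  (forall x, u <= x < v -> exists2 s, x < s <= v & H s - m s <= H x - m x) ->
  H v - m v <= H u - m u.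
Proof.
move=> uv HK mn step.
pose S := [set x | u <= x <= v /\ H x - m x <= H u - m u].
have Su : S u by rewrite /S/= lexx uv.
have Sv : ubound S v by move=> x [/andP[]].
have supS : has_sup S by split; [exists u|exists v].
have us : u <= sup S by apply: ub_le_sup => //; exists v.
have sv : sup S <= v by apply: ge_sup => //; exists u.
have K0 := lipschitz_const_ge0 _ _ HK.
have Ss : S (sup S).
  split; first by rewrite us sv.
  apply/ler_addgt0Pr => e e0.
  (* From a point of [S] this close to [sup S], [H] grows by at most [e]; the [+ 1] covers
     [K = 0]. *)
  have d0 : 0 < e / (K + 1) by rewrite divr_gt0// ltr_wpDl.
  have [x [xuv Sx] sx] := sup_adherent d0 supS.
  have xs : x <= sup S by apply: ub_le_sup; [exists v|split].
  have := HK (sup S) x; rewrite (ger0_norm (x := sup S - x)) ?subr_ge0//.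
  move=> /(le_trans (ler_norm _)) Hx.
  have := mn _ _ xs.
  have : K * (sup S - x) <= e.
    apply: (@le_trans _ _ ((K + 1) * (e / (K + 1)))).
      apply: ler_pM => //; [by rewrite subr_ge0|by rewrite lerDl|lra].
    by rewrite mulrC divfK// gt_eqF// ltr_wpDl.
  lra.
have [vs|vs] := leP v (sup S).
  by have -> : v = sup S; [lra|case: Ss].
have [|s /andP[ss sv'] hs] := step (sup S); first by rewrite us.
have : S s by split; [lra|case: Ss; lra].
move=> /(ub_le_sup (ex_intro _ v Sv)); rewrite leNgt ss //.
Qed.

(* [A] need not be measurable: off the measurable sets [lebesgue_measure] is the
   outer measure, which is still monotone. *)
Lemma full_outer_measure_null {R : realType} (A K : set R) :
  A `<=` `[0, 1] -> lebesgue_measure A = 1%E -> measurable K ->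
  K `<=` `[0, 1] -> A `&` K = set0 -> lebesgue_measure K = 0%E.
Proof.
move=> A01 muA mK K01 AK.
have AD : A `<=` `[0, 1] `\` K.
  by move=> x Ax; split; [exact: A01|move=> Kx; have : (A `&` K) x by []; rewrite AK].
have I1 : lebesgue_measure (`[0, 1]%classic : set R) = 1%E.
  by rewrite lebesgue_measure_itv/= lte_fin ltr01 sube0.
have mI : measurable (`[0, 1]%classic : set R) by exact: measurable_itv.
have le1 : (1 <= lebesgue_measure (`[0%R, 1%R] `\` K : set R))%E.
  by rewrite -muA; exact: le_outer_measure.
have : lebesgue_measure (`[0, 1]%classic : set R) =
    (lebesgue_measure (`[0%R, 1%R] `\` K : set R) + lebesgue_measure K)%E.
  have := @measureDI _ _ _ (@lebesgue_measure R) _ _ mI mK.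
  by rewrite (setIidr K01).
rewrite I1 => E; apply/eqP; rewrite eq_le measure_ge0 andbT.
have := leeD2r (lebesgue_measure K) le1; rewrite -E.
by rewrite -[leRHS]adde0 leeD2lE.
Qed.

(** The shadow set of Riesz's rising sun lemma for [c * x - F x], with [s] kept below [v]. *)
Definition drop_points {R : realType} (F : R -> R) (c v : R) : set R :=
  [set t | exists2 s, t < s <= v & F s - F t < c * (s - t)].

Lemma lipschitz_continuous {R : realType} (F : R -> R) (L : R) :
  (forall x y, `|F x - F y| <= L * `|x - y|) -> continuous F.
Proof.
move=> FL x; apply/cvgrPdist_lt => e e0.
have L0 := lipschitz_const_ge0 _ _ FL.
have d0 : 0 < e / (L + 1) by rewrite divr_gt0// ltr_wpDl.
near=> y; apply: le_lt_trans (FL x y) _.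
have yd : `|x - y| < e / (L + 1).
  near: y; apply/nbhs_ballP; exists (e / (L + 1)) => //=.
move: yd; rewrite ltr_pdivlMr ?ltr_wpDl// mulrDr mulr1 mulrC.
by apply: le_lt_trans; rewrite lerDl.
Unshelve. all: by end_near. Qed.

(** The same [s] serves all points near [t], since both conditions on [t] are strict. *)
Lemma open_drop_points {R : realType} (F : R -> R) (c v : R) :
  continuous F -> open (drop_points F c v).
Proof.
move=> cF; rewrite openE => t [s /andP[ts sv] Fs].
have Gc : {for t, continuous (fun x => F s - F x - c * (s - x))}.
  move=> /=; apply: cvgB; first by apply: cvgB; [exact: cvg_cst|exact: cF].
  by apply: cvgM; [exact: cvg_cst|apply: cvgB; [exact: cvg_cst|exact: cvg_id]].
rewrite /interior; near=> x; exists s.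
  apply/andP; split => //; near: x; exact: lt_nbhsl.
rewrite -subr_lt0; near: x.
by apply: (cvgr_lt _ Gc); rewrite subr_lt0.
Unshelve. all: by end_near. Qed.

(* From each point of [[u, v[] one can move right with slope less than [c], or
   stay in a thin open cover [O] of the null set [K], where the loss is at most
   [C] times the measure of [O] traversed. *)
Lemma slope_le {R : realType} (F : R -> R) (L c u v : R) : u <= v ->
  (forall x y, `|F x - F y| <= L * `|x - y|) ->
  lebesgue_measure (`[u, v[ `\` drop_points F c v : set R) = 0%E ->
  F v - F u <= c * (v - u).
Proof.
move=> uv FL K0; set K := _ `\` _ in K0.
have L0 := lipschitz_const_ge0 _ _ FL.
have mK : measurable (K : set (measurableTypeR R)).
  apply: measurableD; first exact: measurable_itv.
  apply: open_measurable; apply: open_drop_points.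
  exact: lipschitz_continuous FL.
(* A Lipschitz constant of [F x - c * x]. *)
pose C := L + `|c|.
have C0 : 0 <= C by rewrite addr_ge0.
apply/ler_addgt0Pr => e e0.
have d0 : 0 < e / (C + 1) by rewrite divr_gt0// ltr_wpDl.
have [|O [oO KO muO]] := lebesgue_regularity_outer mK _ d0;
  first by rewrite [X in (X < _)%E]K0.
pose E x := O `&` `[u, x] : set R.
have mO : measurable (O : set (measurableTypeR R)) by exact: open_measurable.
have mE x : measurable (E x : set (measurableTypeR R)).
  by apply: measurableI => //; exact: measurable_itv.
have muE x : (lebesgue_measure (E x) <= lebesgue_measure O)%E.
  by apply: le_measure; rewrite ?inE//; exact: subIsetl.
(* Regularity bounds the measure of [O] minus [K]; as [K] is null, this is the measure of [O]. *)
have muOe : (lebesgue_measure O < (e / (C + 1))%:E)%E.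
  have := @measureDI _ _ _ (@lebesgue_measure R) _ _ mO mK.
  rewrite (setIidr KO) [X in (_ + X)%E]K0 adde0 => OE.
  by rewrite -OE in muO.
have finE x : lebesgue_measure (E x) \is a fin_num.
  rewrite ge0_fin_numE//; apply: le_lt_trans (muE x) _.
  exact: lt_trans muOe (ltry _).
pose m x := fine (lebesgue_measure (E x)).
have mn : {homo m : x y / x <= y}.
  move=> x y xy; apply: fine_le => //; apply: le_measure; rewrite ?inE//.
  by apply: setIS; apply: subset_itvl; rewrite bnd_simp.
have mv : m v <= e / (C + 1).
  by rewrite -lee_fin fineK//; exact: le_trans (muE v) (ltW muOe).
have m0 x : 0 <= m x by exact: fine_ge0.
have : F v - c * v - C * m v <= F u - c * u - C * m u; last first.
  have : C * m v <= e.
    apply: (@le_trans _ _ ((C + 1) * (e / (C + 1)))).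
      by apply: ler_pM => //; rewrite lerDl.
    by rewrite mulrC divfK// gt_eqF// ltr_wpDl.
  have := mulr_ge0 C0 (m0 u); lra.
apply: (creeping u v C (fun x => F x - c * x) (fun x => C * m x)) => //.
- move=> x y; rewrite /C mulrDl.
  have -> : F x - c * x - (F y - c * y) = (F x - F y) - c * (x - y) by lra.
  by rewrite (le_trans (ler_normB _ _))// normrM lerD.
- by move=> x y xy; apply: ler_wpM2l => //; exact: mn.
- move=> x /andP[ux xv].
  have [[s /andP[xs sv] Fs]|nx] := pselect (drop_points F c v x).
    exists s; first by rewrite xs.
    have := ler_wpM2l C0 (mn _ _ (ltW xs)); lra.
  have Ox : O x by apply: KO; split => //=; rewrite in_itv/= ux.
  have /nbhs_ballP[r /= r0 xrO] : nbhs x O by exact: open_nbhs_nbhs.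
  (* Half the radius keeps [[x, s]] inside the ball, hence inside [O]. *)
  pose s := Num.min v (x + r / 2).
  have xs : x < s by rewrite lt_min xv ltrDl divr_gt0.
  have sv : s <= v by rewrite ge_min lexx.
  exists s; first by rewrite xs.
  have sr : s <= x + r / 2 by rewrite ge_min lexx orbT.
  (* As []x, s]] lies in [O], [m] gains its whole length, and [C] times that pays for the growth of
     [F x - c * x]. *)
  have ms : m x + (s - x) <= m s.
    have mI : measurable (`]x, s]%classic : set (measurableTypeR R)).
      exact: measurable_itv.
    have mxs : lebesgue_measure (`]x, s]%classic : set R) = (s - x)%:E.
      by rewrite lebesgue_measure_itv/= lte_fin xs.
    rewrite -lee_fin EFinD !fineK// -mxs -measureU//=; last first.
      apply/seteqP; split => // y [[_ /=]]; rewrite !in_itv/=; lra.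
    apply: le_measure; rewrite ?inE//.
      exact: measurableU.
    move=> y [[Oy]|] /=; rewrite in_itv/= => /andP[h1 h2].
      split; [exact: Oy|rewrite /= in_itv/= h1; lra].
    split; last by rewrite /= ?in_itv/=; lra.
    apply: xrO; rewrite /ball/= ltr_distlC; lra.
  have Fsx : F s - F x <= L * (s - x).
    have := FL s x; rewrite (ger0_norm (x := s - x)) ?subr_ge0 ?(ltW xs)//.
    exact: le_trans (ler_norm _).
  have csx : - `|c| * (s - x) <= c * (s - x).
    by apply: ler_wpM2r; [rewrite subr_ge0 ltW|rewrite lerNl -normrN ler_norm].
  have := ler_wpM2l C0 ms.
  rewrite mulrDr {2}/C mulrDl; lra.
Qed.

(** * From the unit interval to the line, and the isometry *)

Lemma mdistRE {R : realType} (x y : R) : mdist (x : R^o) y = `|y - x|.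
Proof. by []. Qed.

Lemma mdist_unit_intervalE {R : realType} (s t : unit_interval R) :
  mdist s t = `|(set_val t : R) - set_val s|.
Proof. by []. Qed.

Lemma in_unit_interval {R : realType} (t : unit_interval R) :
  0 <= (set_val t : R) <= 1.
Proof.
have := set_mem (valP t); by rewrite /unit_interval/= in_itv.
Qed.

Lemma clamp_in_unit_interval {R : realType} (x : R) :
  unit_interval R (Num.max 0 (Num.min 1 x)).
Proof.
by rewrite /unit_interval/= in_itv/= le_max lexx ge_max ler01 ge_min lexx.
Qed.

(** A 1-Lipschitz retraction of the line onto the interval: [h \o clamp] extends [h] with the same
    Lipschitz constant. *)
Definition clamp {R : realType} (x : R) : unit_interval R :=
  SigSub (mem_set (clamp_in_unit_interval x)).

Lemma set_val_clamp {R : realType} (x : R) :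
  set_val (clamp x) = Num.max 0 (Num.min 1 x) :> R.
Proof. by []. Qed.

Lemma clampK {R : realType} (t : unit_interval R) : clamp (set_val t : R) = t.
Proof.
apply: val_inj; have /andP[t0 t1] := in_unit_interval t.
rewrite -[LHS]/(set_val _) set_val_clamp.
by rewrite (min_idPr t1) (max_idPr t0).
Qed.

Lemma mdist_clamp {R : realType} (x y : R) :
  mdist (clamp x) (clamp y) <= `|x - y|.
Proof.
rewrite mdist_unit_intervalE !set_val_clamp.
wlog xy : x y / x <= y.
  move=> H; have [/H//|/ltW/H] := leP x y.
  by rewrite distrC [X in _ <= X]distrC.
rewrite [leRHS]distrC [leRHS]ger0_norm ?subr_ge0// ler_norml.
by rewrite /Num.max /Num.min; do !case: ifPn; rewrite -?leNgt; lra.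
Qed.

(** For slope [c + e], every value of [phi] in [[u, v[] is a drop point, so the other points of [[u,
    v[] miss the range of [phi] and form a null set. *)
Lemma slope_le_of_comp {R : realType} {N : metricType R}
    (phi : N -> unit_interval R) (h : unit_interval R -> R) (L c : R)
    (u v : unit_interval R) :
  lipschitz_map 1 phi ->
  lebesgue_measure (range (fun x : N => set_val (phi x) : R)) = 1%E ->
  (forall t : unit_interval R, range phi t -> exists x : N, phi x = t /\
     pointwise_lip (fun y : N => set_val (phi y) : R) x = 1%E) ->
  lipschitz_map L (h : _ -> R^o) -> 0 <= L ->
  lipschitz_map c (h \o phi : N -> R^o) -> 0 <= c ->
  (set_val u : R) <= set_val v ->
  h v - h u <= c * ((set_val v : R) - set_val u).
Proof.
move=> phi_lip phi_length phi_pointwise hL L0 hc c0 uv.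
suff slope e : 0 < e -> h v - h u <= (c + e) * ((set_val v : R) - set_val u).
  (* Since [v - u <= 1], the extra slope costs at most [e]. *)
  apply/ler_addgt0Pr => e e0; apply: le_trans (slope _ e0) _.
  have /andP[u0 _] := in_unit_interval u.
  have /andP[_ v1] := in_unit_interval v; nra.
move=> e0; rewrite -{1}(clampK v) -{1}(clampK u).
have FL x y : `|h (clamp x) - h (clamp y)| <= L * `|x - y|.
  apply: le_trans (ler_wpM2l L0 (mdist_clamp x y)).
  by have := hL (clamp x) (clamp y); rewrite mdistRE distrC.
apply: (slope_le (h \o @clamp R) L _ _ _ uv FL).
apply: (full_outer_measure_null _ _ _ phi_length).
- by move=> _ [x _ <-]; rewrite /= in_itv/= in_unit_interval.
- apply: measurableD; first exact: measurable_itv.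
  by apply: open_measurable; apply: open_drop_points; exact: lipschitz_continuous FL.
- move=> x [/=]; rewrite !in_itv/= => /andP[ux xv] _.
  have /andP[u0 _] := in_unit_interval u.
  have /andP[_ v1] := in_unit_interval v; lra.
apply/seteqP; split => // _ [[x0 _ <-] [/=]].
rewrite in_itv/= => /andP[ux xv]; apply.
have [x [xE xlip]] := phi_pointwise (phi x0) (ex_intro2 _ _ x0 I erefl).
rewrite -xE in ux xv *.
have ce : 0 < c + e by lra.
(* The ratio [a] satisfies [a < 1] and [c < (c + e) * a]. *)
have a1 : (c + e / 2) / (c + e) < 1 by rewrite ltr_pdivrMr//; lra.
have a0 : 0 < (c + e / 2) / (c + e) by rewrite divr_gt0//; lra.
(* With this radius the 1-Lipschitz [phi] cannot carry [y] beyond [v]. *)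
have r0 : 0 < (set_val v : R) - set_val (phi x) by rewrite subr_gt0.
have ax : (((c + e / 2) / (c + e))%:E <
    pointwise_lip (fun y => set_val (phi y) : R) x)%E by rewrite xlip lte_fin.
have [y [yx yd ay]] := pointwise_lip_witness _ _ _ _ a0 r0 ax.
have d0 : 0 < mdist y x by rewrite mdist_gt0.
(* Without denominators, [ay] bounds [(c + e / 2) * mdist y x] by [(phi y - phi x) * (c + e)]: this
   yields both [phi x < phi y] and the small slope. *)
move: ay; rewrite ltr_pdivlMr// mulrAC ltr_pdivrMr// => ay.
have := hc x y; rewrite mdistRE (metric_sym x y) => /(le_trans (ler_norm _)) hxy.
have := phi_lip x y; rewrite mul1r mdist_unit_intervalE (metric_sym x y).
move=> /(le_trans (ler_norm _)) pyx.
have yxgt0 : 0 < (set_val (phi y) : R) - set_val (phi x).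
  by rewrite -(pmulr_lgt0 _ ce); apply: le_lt_trans ay; apply: mulr_ge0; lra.
exists (set_val (phi y)).
  rewrite -subr_gt0 yxgt0 /=.
  by have := le_lt_trans pyx yd; rewrite ltrD2r; exact: ltW.
rewrite /= !clampK; apply: le_lt_trans hxy _.
rewrite [ltRHS]mulrC; apply: le_lt_trans ay; apply: ler_wpM2r; [exact: ltW|lra].
Qed.

Theorem proposition3p2 (R : realType) (N : metricType R) (p : N)
  (b : unit_interval R) (phi : N -> unit_interval R)
  (phi_lip : lipschitz_map 1 phi)
  (phi_base : phi p = b)
  (phi_length : lebesgue_measure (range (fun x : N => set_val (phi x) : R)) = 1%E)
  (phi_pointwise : forall t : unit_interval R, range phi t ->
     exists x : N, phi x = t /\
       pointwise_lip (fun y : N => set_val (phi y) : R) x = 1%E) :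
  isometric_on (Lip0 b) (Lip0 p) (composition_op phi).
Proof.
move=> f [[k fk] fb].
(* Two distinct points make the set of quotients nonempty, as bounding its [sup] from above
   requires. *)
have clamp01 : @clamp R 0 != clamp 1.
  apply/eqP => /(congr1 (fun t : unit_interval R => set_val t : R)).
  rewrite !set_val_clamp (min_idPr ler01) minxx maxxx (max_idPr ler01).
  by move=> /esym/eqP; rewrite oner_eq0.
have fL := lipschitz_lip_norm fk.
have L0 := lip_norm_ge0 _ _ clamp01 fk.
(* [N] also has two distinct points, because [phi] has pointwise constant 1 at [q]; any positive
   radius and any ratio in []0, 1[] would do. *)
have [q [_ qlip]] := phi_pointwise (phi p) (ex_intro2 _ _ p I erefl).
have [q' [qq' _ _]] : exists y, [/\ y != q, mdist y q < 1 &
    2^-1 < ((set_val (phi y) : R) - set_val (phi q)) / mdist y q].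
  by apply: pointwise_lip_witness; rewrite ?qlip ?lte_fin; lra.
have gL : lipschitz_map (lip_norm f) (composition_op phi f : N -> R^o).
  move=> x y; apply: le_trans (fL (phi x) (phi y)) _.
  by apply: ler_wpM2l => //; have := phi_lip x y; rewrite mul1r.
split; first by split; [exists (lip_norm f)|rewrite /composition_op/= phi_base].
apply/eqP; rewrite eq_le (lip_norm_le _ _ qq' gL)/=.
have gc := lipschitz_lip_norm gL.
have c0 := lip_norm_ge0 _ _ qq' gL.
apply: (lip_norm_le _ _ clamp01) => s t.
wlog st : s t / (set_val s : R) <= set_val t.
  move=> H; have [|/ltW] := leP (set_val s : R) (set_val t); first exact: H.
  by move/H; rewrite metric_sym [X in _ * X]metric_sym.
(* The slope bound is one-sided; applied to [f] and to its negative it controls the absolute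
   value. *)
have lipN (M : metricType R) (h : M -> R) l :
    lipschitz_map l (h : M -> R^o) -> lipschitz_map l ((\- h) : M -> R^o).
  by move=> hl x y; have := hl x y; rewrite !mdistRE /= -opprD normrN.
have := slope_le_of_comp _ _ _ _ _ _ phi_lip phi_length phi_pointwise fL L0 gc c0 st.
have := slope_le_of_comp _ _ _ _ _ _ phi_lip phi_length phi_pointwise
  (lipN _ _ _ fL) L0 (lipN _ _ _ gc) c0 st.
have -> : mdist s t = (set_val t : R) - set_val s.
  by rewrite mdist_unit_intervalE; apply: ger0_norm; rewrite subr_ge0.
by rewrite mdistRE ler_norml /=; lra.
Qed.
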